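(* Let $d=1$ and consider the scalar LQR problem with true optimal policy $\pi^*(s)=Ks$. (1) Optimal-BE. Set $\gamma=\frac{1}{\beta\Delta t+1}$, $\tilde Q=\Delta t\,\gamma\,Q$, $\tilde R=\Delta t\,\gamma\,R$ in the Optimal-BE. Then the difference between the optimal policy $\tilde\pi^*(s)=\tilde Ks$ obtained from the Optimal-BE and the true optimal policy $\pi^*(s)=Ks$ can be bounded by $$|\tilde K-K|\lesssim\left[|B|\left(\sqrt{\frac QR}+\frac{|A|}{|B|}\right)^2+\left|A-\frac\beta2\right|\frac{|A|}{|B|}\right]\Delta t+O(\Delta t^2).$$ (2) Optimal-PhiBE. The difference between the optimal policy $\hat\pi_i^*(s)=\hat K_is$ obtained from the $i$-th order Optimal-PhiBE and the true optimal policy $\pi^*(s)=Ks$ can be bounded by $$|\hat K_i-K|\le\beta\frac{|A|^i}{|B|}\Delta t^i+O(\Delta t^{2i}).$$ In particular, when $\beta=0$, the Optimal-PhiBE gives the exact optimal policy, i.e., $\hat K_i=K$.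
   Context: LQR problem. $A,B,Q,R\in\mathbb R$ with $A\neq0$, $B\ne0$, $Q<0$, $R<0$, noise level $\sigma\in\mathbb R$, discount coefficient $\beta\ge0$ (with $\beta=0$ only considered when $\sigma=0$): $V^*(s)=\max_{a_t=\pi(s_t)}\mathbb E[\int_0^\infty e^{-\beta t}(Qs_t^2+Ra_t^2)dt\mid s_0=s]$ subject to $ds_t=(As_t+Ba_t)dt+\sigma dB_t$ ($B_t$ a scalar Wiener process). The optimal policy is $\pi^*(s)=Ks$ with $K=\frac{(\beta/2-A)-\sqrt{(\beta/2-A)^2+QB^2/R}}{B}$. Discrete data. $\Delta t>0$ is the time step and $\rho_{\Delta t}(s'|s,a)$ is the law of $s_{\Delta t}$ given $s_0=s$ and constant action $a$ on $[0,\Delta t)$. Optimal-BE. $\tilde V^*(s)=\max_a\{\tilde Qs^2+\tilde Ra^2+\gamma\int\tilde V^*(s')\rho_{\Delta t}(s'|s,a)ds'\}$; its solution is taken of the form $\tilde Ps^2+\text{const}$ with $\tilde P<0$, and $\tilde\pi^*(s)=\tilde Ks$ is the maximizing action. (If $\sigma=0$, $s_{\Delta t}$ is a deterministic function of $(s,a)$ and the integral is $\tilde V^*(s_{\Delta t})$.) Optimal-PhiBE. For an integer $i\ge1$, the coefficients $(a^{(i)}_1,\dots,a^{(i)}_i)$ are the unique solution of $\sum_{j=1}^ia^{(i)}_jj^k=1$ for $k=1$ and $=0$ for $2\le k\le i$. Set $\hat b_i(s,a)=\mathbb E[\frac1{\Delta t}\sum_{j=1}^ia^{(i)}_j(s_{j\Delta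 t}-s_0)\mid s_0=s,\ a_\tau=a\text{ for }\tau\in[0,i\Delta t)]$. The $i$-th order Optimal-PhiBE for LQR (the deterministic form is used even if $\sigma\ne0$) is $\beta\hat V_i^*(s)=\max_a\{Qs^2+Ra^2+\hat b_i(s,a)\,(\hat V_i^* )'(s)\}$; its solution is taken of the form $\hat P_is^2$ with $\hat P_i<0$, and $\hat\pi_i^*(s)=\hat K_is$ is the maximizing action. $\lesssim$ means $\le$ up to a universal multiplicative constant; $O(\cdot)$ refers to $\Delta t\to0$, with constants that may depend on $A,B,Q,R,\beta,i$ but not on $\Delta t$.
   Formalization: The exactness claim for β=0 fails for large Δt when i is even and A>0 (e.g. i=2, A=B=1, Q=R=−1, Δt=2); it is stated for all Δt>0 when i is odd or A<0, and only for sufficiently small Δt otherwise. *)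

(* Defs.v *)
From HB Require Import structures.
From mathcomp Require Import all_boot all_order all_algebra.
From mathcomp Require Import all_classical all_reals all_analysis.

Set Implicit Arguments.
Unset Strict Implicit.
Unset Printing Implicit Defensive.

Import Order.TTheory GRing.Theory Num.Theory.
Import numFieldNormedType.Exports.

Local Open Scope classical_set_scope.
Local Open Scope ring_scope.

(* Increments are taken over s < t only: normal_prob 0 0 is the uniform law on
   [0, 1], not a Dirac mass. *)
Definition is_wiener (R : realType) (d : measure_display)
    (T : measurableType d) (P : probability T R) (W : R -> {RV P >-> R}) : Prop :=
  [/\ {ae P, forall w, W 0 w = 0 /\
         {within `[0, +oo[, continuous (fun t => W t w)}},
      forall (s t : R) (E : set R), 0 <= s -> s < t -> measurable E ->
        P [set w | E (W t w - W s w)] = normal_prob 0 (Num.sqrt (t - s)) E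
    & forall (n : nat) (t : nat -> R) (E : nat -> set R),
        0 <= t 0%N -> (forall k, t k <= t k.+1) ->
        (forall k, measurable (E k)) ->
        P (\bigcap_(k in `I_n) [set w | (E k) (W (t k.+1) w - W (t k) w)]) =
        (\prod_(k < n) P [set w | (E k) (W (t k.+1) w - W (t k) w)%R])%E].

(* The equation dX_t = (A X_t + B a) dt + sigma dW_t, X_0 = s, under the
   constant action a. The noise being additive, its integral form involves no
   stochastic integral and is stated pathwise. *)
Definition solves_sde (R : realType) (d : measure_display)
    (T : measurableType d) (P : probability T R) (A B sigma : R)
    (W : R -> {RV P >-> R}) (s a : R) (X : R -> {RV P >-> R}) : Prop :=
  {ae P, forall w,
    {within `[0, +oo[, continuous (fun t => X t w)} /\
    forall t, 0 <= t ->
      X t w = s + \int[lebesgue_measure]_(u in `[0, t]) (A * X u w + B * a)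
              + sigma * W t w}.

(* state S s a t is the state at time t started from s under the constant
   action a. Laws given (s_0, a) = (s, a) only look at times before the action
   changes, so keeping the action constant for all times loses nothing. *)
Record lqr_system (R : realType) (A B sigma : R) := LqrSystem {
  disp : measure_display;
  space : measurableType disp;
  prob : probability space R;
  noise : R -> {RV prob >-> R};
  state : R -> R -> R -> {RV prob >-> R};
  noise_wiener : is_wiener noise;
  state_solves : forall s a, solves_sde A B sigma noise s a (state s a) }.

(* rho_dt( . | s, a) *)
Definition transition (R : realType) (A B sigma : R)
    (S : lqr_system A B sigma) (dt s a : R) : probability R R :=
  distribution (prob S) (state S s a dt).

Definition maximizes (R : realType) (f : R -> \bar R) (a : R) : Prop :=
  forall a', (f a' <= f a)%E.

(* v = max_a f a, the maximum being attained *)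
Definition is_max (R : realType) (f : R -> \bar R) (v : \bar R) : Prop :=
  exists2 a, maximizes f a & f a = v.

(* The gain K of the true optimal policy s |-> K s. *)
Definition lqr_gain (R : realType) (A B q r beta : R) : R :=
  ((beta / 2 - A) - Num.sqrt ((beta / 2 - A) ^+ 2 + q * B ^+ 2 / r)) / B.

Definition be_objective (R : realType) (A B sigma : R)
    (S : lqr_system A B sigma) (dt gamma q r : R) (V : R -> R) (s a : R)
    : \bar R :=
  ((q * s ^+ 2 + r * a ^+ 2)%:E +
   gamma%:E * \int[transition S dt s a]_s' (V s')%:E)%E.

Definition optimal_be_gain (R : realType) (A B sigma : R)
    (S : lqr_system A B sigma) (dt gamma q r K : R) : Prop :=
  exists p c : R, let V := fun s : R => p * s ^+ 2 + c in
  [/\ p < 0,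
      forall s, is_max (be_objective S dt gamma q r V s) (V s)%:E
    & forall s, maximizes (be_objective S dt gamma q r V s) (K * s)].

(* Only the values c 1, ..., c i are used. *)
Definition phibe_coef (R : realType) (i : nat) (c : nat -> R) : Prop :=
  forall k, (1 <= k <= i)%N ->
    \sum_(1 <= j < i.+1) c j * j%:R ^+ k = (k == 1%N)%:R.

Definition phibe_drift (R : realType) (A B sigma : R)
    (S : lqr_system A B sigma) (dt : R) (i : nat) (c : nat -> R) (s a : R)
    : \bar R :=
  'E_(prob S)[fun w => dt^-1 * \sum_(1 <= j < i.+1)
                 c j * (state S s a (j%:R * dt) w - state S s a 0 w)].

Definition phibe_objective (R : realType) (A B sigma : R)
    (S : lqr_system A B sigma) (dt : R) (i : nat) (c : nat -> R) (q r : R)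
    (V : R -> R) (s a : R) : \bar R :=
  ((q * s ^+ 2 + r * a ^+ 2)%:E +
   phibe_drift S dt i c s a * (derive1 V s)%:E)%E.

Definition optimal_phibe_gain (R : realType) (A B sigma : R)
    (S : lqr_system A B sigma) (dt : R) (i : nat) (c : nat -> R)
    (q r beta K : R) : Prop :=
  exists p : R, let V := fun s : R => p * s ^+ 2 in
  [/\ p < 0,
      forall s, is_max (phibe_objective S dt i c q r V s) (beta * V s)%:E
    & forall s, maximizes (phibe_objective S dt i c q r V s) (K * s)].

(* Main.v *)
(** Since the noise is additive, the state started from [s] under the action [a]
    differs from the one started from [0] under [0] by the solution of a linear
    ODE. Nothing else about the noise is needed: the Bellman equation forces the
    moments it involves to be finite and its mean contribution to vanish. The
    first-order condition and the Bellman equation then eliminate the value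
    function and give [K^2 - 2 L K - Q/R = 0] with [B K < 0], for the exact gain
    and for both discretizations, with different [L]; the gains are at distance
    at most twice that of the coefficients [L]. For Optimal-PhiBE the drift has
    rate [D = Phi (A dt) / dt], where the moment conditions on the coefficients
    give [1 - Phi' x = (1 - e^x)^i]; hence [x - Phi x] is at most
    [6/7 |x|^(i+1)] near [0], and both remainders [C dt^2], [C dt^(2i)] can be
    taken to be [0]. *)

Require Import Defs.
From HB Require Import structures.
From mathcomp Require Import all_boot all_order all_algebra.
From mathcomp Require Import all_classical all_reals all_analysis measurable_realfun.
From mathcomp Require Import ring lra.

Set Implicit Arguments.
Unset Strict Implicit.

Import Order.TTheory GRing.Theory Num.Theory.
Import numFieldNormedType.Exports.

Local Open Scope classical_set_scope.
Local Open Scope ring_scope.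

(** * Affine dynamics: the state as a flow plus noise *)

Lemma within_continuous_affine (R : realType) (A : set R) (m k : R) (f : R -> R) :
  {within A, continuous f} -> {within A, continuous (fun x => m * f x + k)}.
Proof.
move=> cf x; apply: cvgD; last exact: cvg_cst.
by apply: cvgM; [exact: cvg_cst|exact: cf].
Qed.

(** Variation of constants from the integral form: [D] is only known to be continuous, so
    differentiability comes from the fundamental theorem of calculus. *)
Lemma affine_integral_equation (R : realType) (A k d0 : R) (D : R -> R) :
  A != 0 -> {within `[0, +oo[, continuous D} ->
  (forall t, 0 <= t ->
     D t = d0 + \int[lebesgue_measure]_(u in `[0, t]) (A * D u + k)) ->
  forall t, 0 <= t -> D t = expR (A * t) * d0 + k / A * (expR (A * t) - 1).
Proof.
move=> A0 cD eqD t t0.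
pose f u := A * D u + k.
pose F x := \int[lebesgue_measure]_(u in `[0, x]) f u.
have F0 : F 0 = 0 by rewrite /F set_itv1 Rintegral_set1.
have cf T : {within `[0, T], continuous f}.
  apply: within_continuous_affine; apply: continuous_subspaceW cD.
  by apply: subset_itvl; rewrite bnd_simp.
have intf T : lebesgue_measure.-integrable `[0, T] (EFin \o f).
  apply: continuous_compact_integrable (cf T); exact: segment_compact.
have derF x : x \in `]0, t[%R -> is_derive x 1 F (f x).
  move=> xt; have /andP[x0 xlt] : 0 < x < t by rewrite in_itv in xt.
  have cfx : {for x, continuous f}.
    exact: within_continuous_continuous (le_lt_trans (ltW x0) xlt) (cf t) xt.
  have [dF Fx] := continuous_FTC1_closed xlt (intf t) x0 cfx.
  by apply: (DeriveDef dF); rewrite -derive1E.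
(* Integrating factor: [d0 + F x] is [D x] for nonnegative [x], and measured from the equilibrium
   [- (k / A)] the product is constant. *)
pose g x := expR (- (A * x)) * (d0 + F x + k / A).
have derg x : x \in `]0, t[%R -> is_derive x 1 g 0.
  move=> xt; have dF := derF x xt.
  have x0 : 0 <= x by move: xt; rewrite in_itv => /andP[/ltW].
  have -> : g = (expR \o (fun y => - (A * y))) * (fun y => d0 + F y + k / A).
    by [].
  apply: is_derive_eq.
  rewrite /= /f (eqD x x0) -/(F x).
  rewrite [LHS](_ : _ = expR (- (A * x)) * ((0 + 1) * (A * (d0 + F x) + k) + 0) +
    (d0 + F x + k / A) * (expR (- (A * x)) * - (A * 1)))//.
  by field.
have cg : {within `[0, t], continuous g}.
  move=> x; apply: cvgM.
    apply: (@continuous_subspaceT _ _ _ (fun y => expR (- (A * y)))) => y.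
    apply: continuous_comp; last exact: continuous_expR.
    by apply: cvgN; apply: cvgM; [exact: cvg_cst|exact: cvg_id].
  apply: cvgD; last exact: cvg_cst.
  apply: cvgD; first exact: cvg_cst.
  exact: parameterized_integral_continuous (intf t) x.
have [c _] := MVT_segment t0 derg cg.
rewrite mul0r => /eqP; rewrite subr_eq0 => /eqP.
rewrite /g F0 mulr0 oppr0 expR0 mul1r addr0 => gE.
rewrite (eqD t t0) -/(F t).
have -> : d0 + F t = expR (A * t) * (d0 + k / A) - k / A.
  rewrite -gE mulrA -expRD subrr expR0 mul1r; ring.
ring.
Qed.

(** Noiseless solution at time [t] of y' = A y + B a, y(0) = s. *)
Definition flow (R : realType) (A B t s a : R) : R :=
  expR (A * t) * s + B / A * (expR (A * t) - 1) * a.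

(** Both states see the same noise path, which cancels in their difference and leaves an affine
    integral equation. One null set serves all [t]. *)
Lemma state_shift (R : realType) (A B sigma : R) (S : lqr_system A B sigma)
    (s a : R) : A != 0 ->
  {ae prob S, forall w, forall t, 0 <= t ->
    state S s a t w = flow A B t s a + state S 0 0 t w}.
Proof.
move=> A0.
have aF := ae_filter_ringOfSetsType (prob S).
apply: filterS2 (state_solves S s a) (state_solves S 0 0) => w.
move=> [cX eX] [cY eY] t t0.
have intY (X : R -> R) (k T : R) : {within `[0, +oo[, continuous X} ->
    lebesgue_measure.-integrable `[0, T] (EFin \o (fun u => A * X u + k)).
  move=> cX'; apply: continuous_compact_integrable; first exact: segment_compact.
  apply: within_continuous_affine; apply: continuous_subspaceW cX'.
  by apply: subset_itvl; rewrite bnd_simp.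
pose D u := state S s a u w - state S 0 0 u w.
have cD : {within `[0, +oo[, continuous D}.
  by move=> x; apply: cvgB; [exact: cX|exact: cY].
have DE := @affine_integral_equation R A (B * a) s D A0 cD _ t t0.
suff : D t = expR (A * t) * s + B * a / A * (expR (A * t) - 1).
  by rewrite /D /flow => /(canRL (subrK _)) ->; ring.
apply: DE => T T0; rewrite /D (eX _ T0) (eY _ T0) mulr0.
have -> : \int[lebesgue_measure]_(u in `[0, T])
    (A * (state S s a u w - state S 0 0 u w) + B * a) =
  \int[lebesgue_measure]_(u in `[0, T]) (A * state S s a u w + B * a) -
  \int[lebesgue_measure]_(u in `[0, T]) (A * state S 0 0 u w + 0).
  rewrite -RintegralB//; last 2 first.
  - exact: intY.
  - exact: intY.
  by apply: eq_Rintegral => u _; ring.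
ring.
Qed.

(** * Integrability and moments *)

(** The integral is a difference of two nonnegative extended reals; it is finite only if both are,
    [+oo - +oo] being infinite too. *)
Lemma fin_num_integrable d (T : measurableType d) (R : realType)
    (mu : {measure set T -> \bar R}) (f : T -> \bar R) :
  measurable_fun [set: T] f -> (\int[mu]_x f x)%E \is a fin_num ->
  mu.-integrable [set: T] f.
Proof.
move=> mf; rewrite integralE => ff.
have p0 : (0 <= \int[mu]_x (f^\+ x))%E by exact: integral_ge0.
have n0 : (0 <= \int[mu]_x (f^\- x))%E by exact: integral_ge0.
apply/integrableP; split => //.
rewrite (_ : (\int[mu]_x `|f x|)%E =
    (\int[mu]_x (f^\+ x) + \int[mu]_x (f^\- x))%E); last first.
  rewrite -ge0_integralD//.
  - by apply: eq_integral => x _; exact: (congr1 (@^~ x) (fune_abse f)).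
  - exact: measurable_funepos.
  - exact: measurable_funeneg.
move: p0 n0 ff; case: (\int[mu]_x (f^\+ x))%E; case: (\int[mu]_x (f^\- x))%E => //=.
by move=> *; rewrite ltry.
Qed.

Lemma ae_eq_integrable d (T : measurableType d) (R : realType)
    (mu : {measure set T -> \bar R}) (f g : T -> \bar R) :
  measurable_fun [set: T] g -> ae_eq mu [set: T] f g ->
  mu.-integrable [set: T] f -> mu.-integrable [set: T] g.
Proof.
move=> mg fg /integrableP[mf fi]; apply/integrableP; split => //.
rewrite -(@ae_eq_integral _ _ _ mu _ _ (abse \o f))//.
- exact: measurableT_comp.
- exact: measurableT_comp.
- exact: ae_eq_comp.
Qed.

Lemma integrable_of_sqr d (T : measurableType d) (R : realType)
    (P : probability T R) (Z : T -> R) :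
  measurable_fun [set: T] Z ->
  P.-integrable [set: T] (fun w => (Z w ^+ 2)%:E) ->
  P.-integrable [set: T] (EFin \o Z).
Proof.
move=> mZ iZ2.
apply: (@le_integrable _ _ _ P _ measurableT _ (fun w => (1 + Z w ^+ 2)%:E)).
- exact/measurable_EFinP.
- move=> w _; rewrite /= lee_fin [leRHS]ger0_norm ?addr_ge0 ?sqr_ge0//.
  by rewrite ler_norml; apply/andP; split; nra.
- apply: (@eq_integrable _ _ _ P _ measurableT ((cst 1%:E) \+ (fun w => (Z w ^+ 2)%:E))) => //.
  by apply: integrableD => //; exact: finite_measure_integrable_cst.
Qed.

Lemma integral_quadratic d (T : measurableType d) (R : realType)
    (P : probability T R) (Z : T -> R) (p c m : R) :
  measurable_fun [set: T] Z ->
  P.-integrable [set: T] (fun w => (Z w ^+ 2)%:E) ->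
  P.-integrable [set: T] (fun w => (p * (m + Z w) ^+ 2 + c)%:E) /\
  (\int[P]_w (p * (m + Z w) ^+ 2 + c)%:E =
   (p * m ^+ 2 + c + 2 * p * m * fine (\int[P]_w (Z w)%:E) +
    p * fine (\int[P]_w (Z w ^+ 2)%:E))%:E)%E.
Proof.
move=> mZ iZ2; have iZ := integrable_of_sqr mZ iZ2.
have i0 : P.-integrable [set: T] (cst (p * m ^+ 2 + c)%:E).
  exact: finite_measure_integrable_cst.
have i1 : P.-integrable [set: T] (fun w => (2 * p * m)%:E * (Z w)%:E)%E.
  exact: integrableZl.
have i2 : P.-integrable [set: T] (fun w => p%:E * (Z w ^+ 2)%:E)%E.
  exact: integrableZl.
have i01 := integrableD measurableT i0 i1.
have -> : (fun w => (p * (m + Z w) ^+ 2 + c)%:E) =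
    ((cst (p * m ^+ 2 + c)%:E \+ (fun w => (2 * p * m)%:E * (Z w)%:E)%E) \+
     (fun w => p%:E * (Z w ^+ 2)%:E)%E)%E.
  apply/funext => w /=; rewrite -!EFinM -!EFinD; congr EFin; ring.
split; first exact: integrableD.
rewrite integralD// integralD// integral_cst//.
rewrite [X in (_ * X + _ + _)%E](_ : _ = 1%E) ?mule1; last exact: probability_setT.
rewrite integralZl// integralZl//.
have f1 : (\int[P]_w (Z w)%:E)%E \is a fin_num by exact: integrable_fin_num.
have f2 : (\int[P]_w (Z w ^+ 2)%:E)%E \is a fin_num by exact: integrable_fin_num.
by rewrite -{1}(fineK f1) -{1}(fineK f2).
Qed.

(* The moments of the noise are not computed: their finiteness is extracted from
   that of the optimal value. *)
Lemma integral_transition (R : realType) (A B sigma : R)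
    (S : lqr_system A B sigma) (dt p c : R) : A != 0 -> 0 <= dt -> p != 0 ->
  (\int[transition S dt 0 0]_y (p * y ^+ 2 + c)%:E)%E \is a fin_num ->
  exists E1 E0 : R, forall s a, let m := flow A B dt s a in
    (\int[transition S dt s a]_y (p * y ^+ 2 + c)%:E)%E =
    (p * m ^+ 2 + 2 * p * E1 * m + E0)%:E.
Proof.
move=> A0 dt0 p0; set V := fun y => (p * y ^+ 2 + c)%:E.
have mV : measurable_fun [set: R] V.
  by apply/measurable_EFinP; apply: measurable_funD => //;
    apply: measurable_funM => //; exact: measurable_funX.
set Z := state S 0 0 dt; have mZ : measurable_fun [set: Defs.space S] Z by [].
move=> /(fin_num_integrable mV) iV.
have iVZ : (prob S).-integrable [set: Defs.space S] (V \o Z).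
  apply/integrableP; split; first exact: measurableT_comp.
  have /integrableP[_] := iV; rewrite ge0_integral_distribution//.
  exact: measurableT_comp.
(* [Z ^+ 2] is recovered from the value function as [(V - c) / p], where [p] is nonzero. *)
have iZ2 : (prob S).-integrable [set: Defs.space S] (fun w => (Z w ^+ 2)%:E).
  have -> : (fun w => (Z w ^+ 2)%:E) =
      ((fun w => (p^-1)%:E * (V \o Z) w) \+ cst (- (c / p))%:E)%E.
    by apply/funext => w; rewrite /V /= -EFinM -EFinD; congr EFin; field.
  apply: integrableD => //; first exact: integrableZl.
  exact: finite_measure_integrable_cst.
exists (fine (\int[prob S]_w (Z w)%:E)), (c + p * fine (\int[prob S]_w (Z w ^+ 2)%:E)).
move=> s a m.
have [im Em] := integral_quadratic p c m mZ iZ2.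
have aeX : ae_eq (prob S) setT (fun w => (p * (m + Z w) ^+ 2 + c)%:E)
    (V \o state S s a dt).
  have aF := ae_filter_ringOfSetsType (prob S).
  by apply: filterS (state_shift S s a A0) => w /(_ _ dt0) /= -> _.
have mX : measurable_fun [set: Defs.space S] (V \o state S s a dt).
  exact: measurableT_comp.
rewrite integral_distribution//; last first.
  exact: ae_eq_integrable aeX im.
transitivity (\int[prob S]_w (p * (m + Z w) ^+ 2 + c)%:E)%E.
  apply: ae_eq_integral => //; last exact: ae_eq_sym.
  exact: measurable_int im.
by rewrite Em; congr EFin; ring.
Qed.

(** Over time j dt the flow moves by (e^(j A dt) - 1)(s + (B/A) a), so the averaged increments of
    two pairs differ almost surely by a constant. Finiteness at one pair [(s0, a0)] thus spreads to
    all, and [nu] is the mean left by the noise. *)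
Lemma phibe_driftE (R : realType) (A B sigma : R) (S : lqr_system A B sigma)
    (dt : R) (i : nat) (c : nat -> R) (s0 a0 : R) : A != 0 -> 0 <= dt ->
  let D := dt^-1 * \sum_(1 <= j < i.+1) c j * (expR (A * dt) ^+ j - 1) in
  phibe_drift S dt i c s0 a0 \is a fin_num ->
  exists nu : R, forall s a,
    phibe_drift S dt i c s a = (D * (s + B / A * a) + nu)%:E.
Proof.
move=> A0 dt0 D; rewrite /phibe_drift.
pose Y s a w := dt^-1 * \sum_(1 <= j < i.+1)
                 c j * (state S s a (j%:R * dt) w - state S s a 0 w).
have mY s a : measurable_fun [set: Defs.space S] (Y s a).
  apply: measurable_funM => //; apply: measurable_sum => j.
  by apply: measurable_funM => //; exact: measurable_funB.
have aeY s a : {ae prob S, forall w, Y s a w = D * (s + B / A * a) + Y 0 0 w}.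
  have aF := ae_filter_ringOfSetsType (prob S).
  apply: filterS (state_shift S s a A0) => w Xw.
  rewrite /Y /D -mulrA -mulrDr; congr (_ * _).
  rewrite mulr_suml -big_split/=; apply: eq_bigr => j _.
  rewrite !Xw// ?mulr_ge0// /flow mulr0 expR0 mulrCA expRM_natl; ring.
have aeY' s a s' a' : ae_eq (prob S) setT (EFin \o Y s a)
    (fun w => (D * (s - s' + B / A * (a - a')))%:E + (Y s' a' w)%:E)%E.
  have aF := ae_filter_ringOfSetsType (prob S).
  apply: filterS2 (aeY s a) (aeY s' a') => w Y1 Y2 _ /=.
  by rewrite Y1 Y2 -EFinD; congr EFin; ring.
have mYe s a : measurable_fun [set: Defs.space S] (EFin \o Y s a).
  exact/measurable_EFinP.
have icst r : (prob S).-integrable [set: Defs.space S] (cst r%:E).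
  exact: finite_measure_integrable_cst.
rewrite [@expectation]unlock => /(fin_num_integrable (mYe s0 a0)) iY.
have iY0 : (prob S).-integrable [set: Defs.space S] (EFin \o Y 0 0).
  apply: ae_eq_integrable (ae_eq_sym (aeY' 0 0 s0 a0)) _ => //.
  exact: integrableD (icst _) iY.
exists (fine (\int[prob S]_w (Y 0 0 w)%:E)) => s a.
transitivity (\int[prob S]_w ((D * (s + B / A * a))%:E + (Y 0 0 w)%:E))%E.
  apply: ae_eq_integral => //.
    exact: mYe.
    by have /measurable_int := integrableD measurableT (icst (D * (s + B / A * a))) iY0.
  by apply: filterS (aeY' s a 0 0) => w; rewrite !subr0.
rewrite (integralD measurableT (icst _) iY0) integral_cst//.
rewrite [X in (_ * X + _)%E](_ : _ = 1%E) ?mule1; last exact: probability_setT.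
rewrite EFinD fineK//; exact: integrable_fin_num.
Qed.

(** * From Bellman equations to quadratic equations for the gains *)

Lemma quadratic_max (R : realFieldType) (u v k : R) :
  (forall a, u * a ^+ 2 + v * a <= u * k ^+ 2 + v * k) -> 2 * u * k + v = 0.
Proof.
move=> kmax; set w := 2 * u * k + v; apply/eqP/negPn/negP => w0.
have u0 : 0 < 1 + `|u| by rewrite ltr_wpDr.
(* Moving along the slope [w], damped by [1 + |u|], gives a strict gain whatever the sign of [u]. *)
have := kmax (k + w / (1 + `|u|)).
have -> : u * (k + w / (1 + `|u|)) ^+ 2 + v * (k + w / (1 + `|u|)) =
    u * k ^+ 2 + v * k + w ^+ 2 * (1 + `|u| + u) / (1 + `|u|) ^+ 2.
  by rewrite /w; field; rewrite gt_eqF.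
rewrite gerDl leNgt => /negP; apply.
rewrite divr_gt0 ?exprn_gt0// mulr_gt0 ?exprn_even_gt0//.
by have := ler_norm (- u); rewrite normrN; lra.
Qed.

Lemma is_max_maximizes (R : realType) (f : R -> \bar R) (v : \bar R) (a : R) :
  is_max f v -> maximizes f a -> f a = v.
Proof.
by move=> [b fb <-] fa; apply/eqP; rewrite eq_le fb fa.
Qed.

Lemma expR_eq1 (R : realType) (x : R) : (expR x == 1) = (x == 0).
Proof. by rewrite -expR0 (inj_eq (@expR_inj R)). Qed.

Lemma optimal_be_gain_equations (R : realType) (A B sigma : R)
    (S : lqr_system A B sigma) (dt gamma q r K : R) :
  A != 0 -> B != 0 -> 0 < dt -> 0 < gamma -> optimal_be_gain S dt gamma q r K ->
  let al := expR (A * dt) in let b := B / A * (al - 1) in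
  exists2 p, p < 0 & r * K + gamma * p * b * (al + b * K) = 0 /\
    p = q + r * K ^+ 2 + gamma * p * (al + b * K) ^+ 2.
Proof.
move=> A0 B0 dt0 g0 [p [c [p0 Vmax Kmax]]] al b; exists p => //.
have VK s := is_max_maximizes (Vmax s) (Kmax s).
have b0 : b != 0.
  by rewrite !mulf_neq0 ?invr_eq0// subr_eq0 expR_eq1 mulf_neq0// gt_eqF.
have pn0 : p != 0 by rewrite lt_eqF.
(* At [s = 0] the Bellman equation equates the objective with the real number [c], which an infinite
   integral would contradict. *)
have [] := @integral_transition R A B sigma S dt p c A0 (ltW dt0) pn0.
  have := VK 0; rewrite mulr0 /be_objective.
  case: (\int[_]_s' _)%E => //.
    by rewrite gt0_muley ?lte_fin// addey.
  by rewrite gt0_muleNy ?lte_fin// addeNy.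
move=> E1 [E0 intV].
have objE s a : be_objective S dt gamma q r (fun s => p * s ^+ 2 + c) s a =
    (q * s ^+ 2 + r * a ^+ 2 + gamma * (p * (al * s + b * a) ^+ 2 +
       2 * p * E1 * (al * s + b * a) + E0))%:E.
  by rewrite /be_objective intV.
have focs s : 2 * (r + gamma * p * b ^+ 2) * (K * s) +
   (2 * gamma * p * b * al * s + 2 * gamma * p * b * E1) = 0.
  apply: quadratic_max => a.
  have := Kmax s a; rewrite !objE lee_fin => h.
  rewrite -subr_ge0; rewrite -subr_ge0 in h; apply: le_trans h _.
  by rewrite le_eqVlt; apply/orP; left; apply/eqP; ring.
(* At [s = 0] the maximizing action is [0], so the first-order condition retains only the noise mean
   [E1]. *)
have E10 : E1 = 0.
  have := focs 0; rewrite !mulr0 !add0r => /eqP.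
  rewrite mulf_eq0 => /orP[/negPn/negP[]|/eqP//].
  by apply: mulf_neq0 => //; apply: mulf_neq0 => //; rewrite mulf_neq0// gt_eqF.
split.
  have := focs 1; rewrite E10 => h.
  have -> : r * K + gamma * p * b * (al + b * K) =
    2^-1 * (2 * (r + gamma * p * b ^+ 2) * (K * 1) +
   (2 * gamma * p * b * al * 1 + 2 * gamma * p * b * 0)) by field.
  by rewrite h mulr0.
(* The difference of the values at [1] and [0] eliminates [c] and [E0]. *)
have := VK 1; have := VK 0; rewrite !objE => -[h0] [h1].
move: h0 h1; rewrite E10 => h0 h1; nra.
Qed.

Lemma optimal_phibe_gain_equations (R : realType) (A B sigma : R)
    (S : lqr_system A B sigma) (dt : R) (i : nat) (c : nat -> R)
    (q r beta K : R) :
  A != 0 -> 0 < dt -> optimal_phibe_gain S dt i c q r beta K ->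
  let D := dt^-1 * \sum_(1 <= j < i.+1) c j * (expR (A * dt) ^+ j - 1) in
  exists2 p, p < 0 & r * K + p * D * (B / A) = 0 /\
    beta * p = q + r * K ^+ 2 + 2 * p * D * (1 + B / A * K).
Proof.
move=> A0 dt0 [p [p0 Vmax Kmax]] D; exists p => //.
have VK s := is_max_maximizes (Vmax s) (Kmax s).
have dV s : derive1 (fun x : R => p * x ^+ 2) s = 2 * p * s.
  rewrite derive1E; have dX : is_derive s 1 (fun x : R => p * x ^+ 2) (2 * p * s).
    by apply: is_derive_eq; rewrite /GRing.scale /=; ring.
  exact: derive_val.
(* Finiteness is read off at [s = 1]: at [s = 0] the derivative of the value vanishes and would hide
   an infinite drift. *)
have [] := @phibe_driftE R A B sigma S dt i c 1 K A0 (ltW dt0).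
  have := VK 1; rewrite mulr1 /phibe_objective dV.
  case: (phibe_drift S dt i c 1 K) => //.
    by rewrite lt0_mulye ?lte_fin ?addeNy//; nra.
  by rewrite lt0_mulNye ?lte_fin ?addey//; nra.
rewrite -/D => nu driftE.
have objE s a : phibe_objective S dt i c q r (fun s => p * s ^+ 2) s a =
    (q * s ^+ 2 + r * a ^+ 2 + (D * (s + B / A * a) + nu) * (2 * p * s))%:E.
  by rewrite /phibe_objective driftE dV.
split.
  have : 2 * r * K + 2 * p * D * (B / A) = 0.
    apply: quadratic_max => a.
    have := Kmax 1 a; rewrite !objE lee_fin => h; lra.
  by move=> h; lra.
(* The [nu] term is odd in [s], so adding the equations at [1] and [-1] cancels it. *)
have := VK 1; have := VK (-1); rewrite !objE => -[h0] [h1].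
lra.
Qed.

(* Both closed-loop gains are the roots, of the sign opposite to that of [B], of
   equations of this shape that differ only in their linear coefficient. *)
Lemma quadratic_root_dist (R : realFieldType) (rho L L' K K' : R) :
  0 < rho -> 0 < K * K' ->
  K ^+ 2 - 2 * L * K - rho = 0 -> K' ^+ 2 - 2 * L' * K' - rho = 0 ->
  `|K' - K| <= 2 * `|L' - L|.
Proof.
move=> rho0 KK eK eK'.
(* [K] times the second equation minus [K'] times the first; the ratio [K * K' / (K * K' + rho)]
   then lies below 1. *)
have e : (K' - K) * (K * K' + rho) = 2 * (L' - L) * (K * K').
  have -> : (K' - K) * (K * K' + rho) =
      2 * (L' - L) * (K * K') + K * (K' ^+ 2 - 2 * L' * K' - rho) -
      K' * (K ^+ 2 - 2 * L * K - rho) by ring.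
  by rewrite eK eK' !mulr0 subr0 addr0.
have pos : 0 < K * K' + rho by rewrite addr_gt0.
rewrite -(ler_pM2r pos) -[X in _ * X <= _](gtr0_norm pos) -normrM e.
rewrite normrM (gtr0_norm KK) normrM (@ger0_norm _ 2)// ler_wpM2l ?mulr_ge0//.
by rewrite lerDl ltW.
Qed.

(** The two roots have product [- (q / r) < 0]. The square root exceeds [|beta / 2 - A|], so the
    minus sign before it selects the root with [B * K < 0]. *)
Lemma lqr_gain_root (R : realType) (A B q r beta : R) :
  B != 0 -> q < 0 -> r < 0 ->
  let K := lqr_gain A B q r beta in
  B * K < 0 /\ K ^+ 2 - 2 * ((beta / 2 - A) / B) * K - q / r = 0.
Proof.
move=> B0 q0 r0 K; rewrite /K /lqr_gain.
have rho0 : 0 < q / r by rewrite nmulr_rgt0// invr_lt0.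
set u := beta / 2 - A.
have uB : 0 < q * B ^+ 2 / r by rewrite mulrAC mulr_gt0// exprn_even_gt0.
have := sqr_sqrtr (addr_ge0 (sqr_ge0 u) (ltW uB)).
set s := Num.sqrt _ => ss; split.
  rewrite mulrC divfK// subr_lt0.
  apply: le_lt_trans (ler_norm u) _; rewrite -sqrtr_sqr ltr_sqrt ?ltrDl//.
  by rewrite ltr_wpDl ?sqr_ge0.
have -> : ((u - s) / B) ^+ 2 - 2 * (u / B) * ((u - s) / B) - q / r =
    (s ^+ 2 - (u ^+ 2 + q * B ^+ 2 / r)) / B ^+ 2.
  by field; rewrite B0 lt_eqF.
by rewrite ss subrr mul0r.
Qed.

(** With w = al + b K, multiply the first equation by 1 + beta h - w^2 and the second by b w: [p]
    drops out, the terms cubic in [K] cancel, and a quadratic remains. *)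
Lemma be_gain_root (R : realFieldType) (h beta q r p al b K : R) :
  0 < h -> q < 0 -> r < 0 -> p < 0 -> 0 < al -> b != 0 ->
  h * r * K + p * b * (al + b * K) = 0 ->
  p * (1 + beta * h) = h * (q + r * K ^+ 2) + p * (al + b * K) ^+ 2 ->
  b * K < 0 /\
  K ^+ 2 - 2 * ((1 + beta * h - al ^+ 2 + q / r * b ^+ 2) / (2 * al * b)) * K
    - q / r = 0.
Proof.
move=> h0 q0 r0 p0 al0 b0 foc val.
have b2 : 0 < b ^+ 2 by rewrite exprn_even_gt0.
have hr : h * r < 0 by rewrite pmulr_rlt0.
have pb2 : p * b ^+ 2 < 0 by rewrite nmulr_rlt0.
split.
  (* [b] times the first-order condition isolates [b * K], whose sign is then visible. *)
  have e : (h * r + p * b ^+ 2) * (b * K) = - p * b ^+ 2 * al.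
    apply/eqP; rewrite -subr_eq0; apply/eqP.
    transitivity (b * (h * r * K + p * b * (al + b * K))); first ring.
    by rewrite foc mulr0.
  have d0 : h * r + p * b ^+ 2 < 0 by lra.
  rewrite -(nmulr_rgt0 _ d0) e mulr_gt0//; lra.
have al_neq0 : al != 0 by rewrite gt_eqF.
have r_neq0 : r != 0 by rewrite lt_eqF.
have h_neq0 : h != 0 by rewrite gt_eqF.
have [w0|w0] := eqVneq (al + b * K) 0.
  move: foc; rewrite w0 mulr0 addr0 => /eqP.
  rewrite mulf_eq0 lt_eqF//= => /eqP K0.
  by move: w0; rewrite K0 mulr0 addr0 => /eqP; rewrite (negbTE al_neq0).
have -> : K ^+ 2 - 2 * ((1 + beta * h - al ^+ 2 + q / r * b ^+ 2) / (2 * al * b)) * K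
    - q / r =
    (al * b * K ^+ 2 * r - ((1 + beta * h - al ^+ 2) * r + q * b ^+ 2) * K
     - q * al * b) / (r * al * b).
  by field; rewrite r_neq0 al_neq0 b0.
apply/eqP; rewrite mulf_eq0; apply/orP; left; apply/eqP.
apply: (mulfI h_neq0); rewrite mulr0.
have -> : h * (al * b * K ^+ 2 * r -
     ((1 + beta * h - al ^+ 2) * r + q * b ^+ 2) * K - q * al * b) =
  - (h * r * K + p * b * (al + b * K)) * (1 + beta * h - (al + b * K) ^+ 2) +
  b * (al + b * K) * (p * (1 + beta * h) - (h * (q + r * K ^+ 2) + p * (al + b * K) ^+ 2)).
  ring.
by rewrite foc val subrr oppr0 mul0r mulr0 addr0.
Qed.

(** The first-order condition makes [K] a multiple of [p], and substitution eliminates [p]. The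
    linear coefficient differs from the exact one only by the factor [A / D] on [beta / 2], hence
    exactness for [beta = 0]. *)
Lemma phibe_gain_root (R : realFieldType) (A B q r beta p D K : R) :
  A != 0 -> B != 0 -> r < 0 -> p < 0 -> 0 < D / A ->
  r * K + p * D * (B / A) = 0 ->
  beta * p = q + r * K ^+ 2 + 2 * p * D * (1 + B / A * K) ->
  B * K < 0 /\
  K ^+ 2 - 2 * ((beta / 2 * (A / D) - A) / B) * K - q / r = 0.
Proof.
move=> A0 B0 r0 p0 DA foc val.
have r_neq0 : r != 0 by rewrite lt_eqF.
have D0 : D != 0 by apply: contraTneq DA => ->; rewrite mul0r ltxx.
have Ke : K = - (p / r) * (D / A) * B.
  apply: (mulfI r_neq0); rewrite -[LHS](addrK (p * D * (B / A))) foc.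
  by field; rewrite A0 r_neq0.
have pr : 0 < p / r by rewrite nmulr_rgt0// invr_lt0.
split.
  rewrite Ke (_ : B * _ = - (p / r * (D / A) * B ^+ 2)); last ring.
  by rewrite oppr_lt0 (mulr_gt0 (mulr_gt0 pr DA))// exprn_even_gt0.
have qe : q = beta * p - r * K ^+ 2 - 2 * p * D * (1 + B / A * K).
  by rewrite val; ring.
by rewrite qe Ke; field; rewrite A0 B0 D0 r_neq0.
Qed.

(** * Error of the Optimal-BE coefficient *)

Lemma expRB1_bounds (R : realType) (x : R) : `|x| <= 1 / 4 ->
  x <= expR x - 1 <= x + 4 / 3 * x ^+ 2.
Proof.
rewrite ler_norml => /andP[x1 x2]; apply/andP; split.
  by rewrite lerBrDl expR_ge1Dx.
(* From e^x (1 - x) <= 1; the constant 4/3 is 1/(1 - x) at x = 1/4. *)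
have := expR_ge1Dx (- x); have e0 := expR_gt0 x.
rewrite -(ler_pM2l e0) -expRD subrr expR0 => h.
suff : (expR x - 1) * (1 - x) <= (x + 4 / 3 * x ^+ 2) * (1 - x).
  by rewrite ler_pM2r//; lra.
have := sqr_ge0 x; nra.
Qed.

Lemma be_coef_dist (R : realType) (A B rho beta h al b : R) :
  A != 0 -> B != 0 -> 0 <= rho -> 0 <= beta -> 0 < h -> `|A * h| <= 1 / 4 ->
  al = expR (A * h) -> b = B / A * (al - 1) ->
  `|(1 + beta * h - al ^+ 2 + rho * b ^+ 2) / (2 * al * b) - (beta / 2 - A) / B|
    <= 12 * ((`|B| * (Num.sqrt rho + `|A| / `|B|) ^+ 2
               + `|A - beta / 2| * (`|A| / `|B|)) * h).
Proof.
move=> A0 B0 rho0 beta0 h0 x4 alx bE.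
set x := A * h in x4 alx; have x0 : x != 0 by rewrite mulf_neq0// gt_eqF.
have /andP[e1 e2] := expRB1_bounds x4.
rewrite -alx in e1 e2; set e := al - 1 in e1 e2 bE.
have [xl xr] : - (1 / 4) <= x /\ x <= 1 / 4 by apply/andP; rewrite -ler_norml.
have alE : al = 1 + e by rewrite /e; ring.
have e0 : e != 0 by rewrite subr_eq0 alx expR_eq1.
have al0 : 0 < al by rewrite alx expR_gt0.
have al34 : 3 / 4 <= al by rewrite alE; lra.
have [e_sq' al_e] : e ^+ 2 <= 16 / 9 * x ^+ 2 /\ `|x| <= `|2 * al * e|.
  have [x0'|x0'] := leP 0 x.
    have ex : e <= 4 / 3 * x by nra.
    have ale : x <= 2 * al * e by nra.
    split; first by nra.
    by rewrite !ger0_norm//; lra.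
  have ex : e <= 2 / 3 * x by nra.
  have ale : 2 * al * e <= x by nra.
  split; first by nra.
  by rewrite !ltr0_norm//; lra.
have x_sq0 := sqr_ge0 x.
have e_sq : e ^+ 2 <= 4 * x ^+ 2 by lra.
have rem : `|x - e - e ^+ 2| <= 4 * x ^+ 2 by rewrite ler_norml; apply/andP; split; nra.
(* With [e = al - 1] all first-order terms cancel: the numerator is of order [h ^+ 2], the
   denominator of order [h]. *)
have -> : (1 + beta * h - al ^+ 2 + rho * b ^+ 2) / (2 * al * b) - (beta / 2 - A) / B =
  (rho * (B / A) ^+ 2 * e ^+ 2 + e ^+ 2 + beta / A * (x - e - e ^+ 2)) / (2 * al * b).
  rewrite bE /x alE; field; rewrite A0 B0 e0 -alE gt_eqF//.
have bpos : 0 < `|B| * h by rewrite mulr_gt0// normr_gt0.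
have den : `|B| * h <= `|2 * al * b|.
  have -> : 2 * al * b = B / A * (2 * al * e) by rewrite bE; ring.
  rewrite normrM normrM normfV -mulrA ler_wpM2l//.
  rewrite -(ler_pM2l (_ : 0 < `|A|)) ?normr_gt0// mulrA divff ?normr_eq0// mul1r.
  by rewrite -[X in _ * X]gtr0_norm// -normrM.
rewrite normrM normfV ler_pdivrMr ?(lt_le_trans bpos den)//.
have A2 : A ^+ 2 = `|A| ^+ 2 by rewrite real_normK ?num_real.
set main := `|B| * _ + _.
(* Expanding the square and dropping its nonnegative cross term. *)
have mainB : rho * B ^+ 2 + A ^+ 2 + `|A - beta / 2| * `|A| <= main * `|B|.
  have -> : main * `|B| = (`|B| * Num.sqrt rho + `|A|) ^+ 2 + `|A - beta / 2| * `|A|.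
    by rewrite /main; field; rewrite normr_eq0.
  rewrite lerD2r sqrrD exprMn sqr_sqrtr// !real_normK ?num_real// mulrC.
  by rewrite lerD2r lerDl mulrn_wge0// !mulr_ge0.
have main0 : 0 <= main by rewrite addr_ge0// !mulr_ge0 ?sqr_ge0// ?invr_ge0.
apply: (@le_trans _ _ (12 * (main * h) * (`|B| * h))); last first.
  by rewrite ler_wpM2l// mulr_ge0// mulr_ge0// ltW.
(* The 4 comes from the bounds by [4 * x ^+ 2]; absorbing [beta * |A|] into the main term costs a
   further factor 3, whence 12. *)
apply: (@le_trans _ _ (4 * h ^+ 2 * (rho * B ^+ 2 + A ^+ 2 + beta * `|A|))); last first.
  have h2 : 0 <= h ^+ 2 := sqr_ge0 _.
  have bA : beta * `|A| <= 2 * (`|A - beta / 2| * `|A|) + 2 * A ^+ 2.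
    have : beta <= 2 * `|A - beta / 2| + 2 * `|A|.
      have := ler_norm A; have := ler_norm (- (A - beta / 2)); rewrite normrN; lra.
    move/(ler_wpM2r (normr_ge0 A)); rewrite A2; lra.
  have := sqr_ge0 A; have := mulr_ge0 rho0 (sqr_ge0 B).
  have -> : 12 * (main * h) * (`|B| * h) = 4 * h ^+ 2 * (3 * (main * `|B|)) by ring.
  move=> ? ?; apply: ler_wpM2l; first by apply: mulr_ge0.
  have : 0 <= `|A - beta / 2| * `|A| by rewrite mulr_ge0.
  lra.
have -> : 4 * h ^+ 2 * (rho * B ^+ 2 + A ^+ 2 + beta * `|A|) =
   rho * (B / A) ^+ 2 * (4 * x ^+ 2) + 4 * x ^+ 2 + beta / `|A| * (4 * x ^+ 2).
  rewrite !mulrDr; congr (_ + _ + _); rewrite /x.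
  - by field.
  - by ring.
  - by rewrite exprMn A2; field; rewrite normr_eq0.
apply: le_trans (ler_normD _ _) _; apply: lerD; last first.
  by rewrite !normrM normfV (ger0_norm beta0) ler_wpM2l// divr_ge0.
rewrite ger0_norm; last first.
  by rewrite addr_ge0 ?sqr_ge0// mulr_ge0 ?sqr_ge0// mulr_ge0 ?sqr_ge0.
by rewrite lerD// ler_wpM2l// mulr_ge0 ?sqr_ge0.
Qed.

(** * The PhiBE coefficients and their exponential stencil *)

(** The moment conditions in dual form. The factor [j] turns the monomial of degree [k] into the
    moment of order [k + 1]. *)
Lemma phibe_coef_horner (R : realType) (i : nat) (c : nat -> R) (p : {poly R}) :
  phibe_coef i c -> (size p <= i)%N ->
  \sum_(1 <= j < i.+1) c j * (j%:R * p.[j%:R]) = p.[0].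
Proof.
move=> hc pi; transitivity (\sum_(k < i) p`_k * (k == 0%N :> nat)%:R).
  under eq_bigr => j _ do rewrite (horner_coef_wide _ pi) !mulr_sumr.
  rewrite exchange_big/=; apply: eq_bigr => k _.
  have <- : \sum_(1 <= j < i.+1) c j * j%:R ^+ k.+1 = (k == 0%N :> nat)%:R.
    by rewrite hc//= ltn_ord.
  by rewrite mulr_sumr; apply: eq_bigr => j _; rewrite exprS; ring.
rewrite (horner_coef_wide _ pi); apply: eq_bigr => k _.
by rewrite expr0n.
Qed.

Lemma horner_falling_factorial (R : comNzRingType) (n k : nat) :
  (\prod_(m <- iota 0 k) ('X - m%:R%:P : {poly R})).[n%:R] = (n ^_ k)%:R.
Proof.
elim: k => [|k IH]; first by rewrite big_nil hornerC.
rewrite -addn1 iotaD big_cat big_seq1 hornerM IH addn1 ffactnSr natrM hornerXsubC add0n.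
have [kn|nk] := leqP k n; first by rewrite natrB.
by rewrite ffact_small// !mul0r.
Qed.

(** [k!] times the binomial is the falling factorial, a polynomial in [j] of degree [k < i] that
    vanishes at 0 unless [k = 0]. *)
Lemma phibe_coef_bin (R : realType) (i : nat) (c : nat -> R) (k : nat) :
  phibe_coef i c -> (k < i)%N ->
  \sum_(1 <= j < i.+1) c j * j%:R * 'C(j, k)%:R = (k == 0%N)%:R.
Proof.
move=> hc ki.
have k0 : (k`!)%:R != 0 :> R by rewrite pnatr_eq0 -lt0n fact_gt0.
have := @phibe_coef_horner R i c (\prod_(m <- iota 0 k) ('X - m%:R%:P)) hc.
rewrite size_prod_XsubC size_iota => /(_ ki).
rewrite (horner_falling_factorial R 0 k) ffact0n => h.
apply: (mulfI k0); rewrite mulr_sumr.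
transitivity ((k == 0%N)%:R : R); last by case: k {ki k0 h} => [|k]; rewrite ?mulr1 ?mulr0.
rewrite -h; apply: eq_bigr => j _.
by rewrite horner_falling_factorial -bin_ffact natrM; ring.
Qed.

(* In [z = y - 1] the moment conditions determine all coefficients but the
   leading one, which the value at [y = 0] then fixes. *)
Lemma phibe_coef_deriv (R : realType) (i : nat) (c : nat -> R) (y : R) :
  (1 <= i)%N -> phibe_coef i c ->
  \sum_(1 <= j < i.+1) c j * j%:R * y ^+ j = 1 - (1 - y) ^+ i.
Proof.
move=> i0 hc.
pose S := \sum_(1 <= j < i.+1) c j * j%:R * 'C(j, i)%:R.
have expand z : \sum_(1 <= j < i.+1) c j * j%:R * z ^+ j = 1 + S * (z - 1) ^+ i.
  transitivity (\sum_(k < i.+1)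
     (\sum_(1 <= j < i.+1) c j * j%:R * 'C(j, k)%:R) * (z - 1) ^+ k).
    under [RHS]eq_bigr do rewrite mulr_suml.
    rewrite exchange_big/= !big_nat; apply: eq_bigr => j /andP[_ ji].
    rewrite -{1}(subrK 1 z) [z - 1 + 1]addrC exprDn mulr_sumr.
    rewrite (big_ord_widen _
      (fun k => c j * j%:R * (1 ^+ (j - k) * (z - 1) ^+ k *+ 'C(j, k))) ji).
    rewrite big_mkcond; apply: eq_bigr => k _; case: ifPn => [_|].
      by rewrite expr1n mul1r -mulr_natl; ring.
    by rewrite -leqNgt => jk; rewrite bin_small// mulr0 mul0r.
  rewrite big_ord_recr/=; congr (_ + _).
  rewrite -(prednK i0) big_ord_recl/= phibe_coef_bin ?prednK// expr0 mul1r.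
  by rewrite big1 ?addr0// => k _; rewrite phibe_coef_bin ?mul0r//= /bump/= add1n -ltn_predRL.
have S0 : S * (-1) ^+ i = - 1.
  apply/eqP; rewrite -addr_eq0 addrC -[-1]sub0r -expand big_nat big1// => j /andP[j1 _].
  by rewrite expr0n gtn_eqF// mulr0.
by rewrite expand -opprB exprNn mulrA S0 mulN1r.
Qed.

Lemma is_derive_exp_sum (R : realType) (c : nat -> R) (n : nat) (x : R) :
  is_derive x 1 (fun y => \sum_(1 <= j < n.+1) c j * (expR y ^+ j - 1))
    (\sum_(1 <= j < n.+1) c j * j%:R * expR x ^+ j).
Proof.
elim: n => [|n IH].
  rewrite big_geq// (_ : (fun _ => _) = cst 0); first exact: is_derive_cst.
  by apply/funext => y; rewrite big_geq.
rewrite big_nat_recr//= (_ : (fun y => _) =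
    (fun y => \sum_(1 <= j < n.+1) c j * (expR y ^+ j - 1)) +
    (fun y => c n.+1 * (expR y ^+ n.+1 - 1))); last first.
  by apply/funext => y; rewrite big_nat_recr.
apply: is_deriveD.
under eq_fun do rewrite -expRM_natl.
by apply: is_derive_eq; rewrite /GRing.scale/= expRM_natl; ring.
Qed.

Lemma derive_lipschitz (R : realType) (f df : R -> R) (M rad a b : R) :
  (forall t : R, is_derive t 1 f (df t)) -> (forall t, `|t| <= rad -> `|df t| <= M) ->
  `|a| <= rad -> `|b| <= rad -> `|f b - f a| <= M * `|b - a|.
Proof.
move=> dfP dfM; wlog ab : a b / a <= b.
  move=> h ar br; have [ab|/ltW ba] := leP a b; first exact: h.
  by rewrite distrC (distrC b); exact: h.
move=> ar br; have cf : {within `[a, b], continuous f}.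
  apply: continuous_subspaceT => t; apply: differentiable_continuous.
  by apply/derivable1_diffP; have [] := dfP t.
have [t tab ->] := MVT_segment ab (fun t _ => dfP t) cf.
rewrite normrM ler_wpM2r// dfM//.
move: tab; rewrite in_itv/= => /andP[at_ tb].
move: ar br; rewrite !ler_norml => /andP[? ?] /andP[? ?].
by apply/andP; split; lra.
Qed.

(** At [x = A * dt] this is [dt] times the drift rate seen by PhiBE; the exact dynamics would give
    [x] itself. *)
Definition exp_stencil (R : realType) (i : nat) (c : nat -> R) (x : R) : R :=
  \sum_(1 <= j < i.+1) c j * (expR x ^+ j - 1).

Section exp_stencil.
Variables (R : realType) (i : nat) (c : nat -> R).
Hypotheses (i0 : (1 <= i)%N) (hc : phibe_coef i c).
Local Notation Phi := (exp_stencil i c).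
Let rem x := x - Phi x.

Let rem_derive (x : R) : is_derive x 1 rem ((1 - expR x) ^+ i).
Proof.
have -> : (1 - expR x) ^+ i = 1 - \sum_(1 <= j < i.+1) c j * j%:R * expR x ^+ j.
  by rewrite phibe_coef_deriv//; ring.
have dPhi := is_derive_exp_sum c i x.
exact: is_deriveB.
Qed.

Let rem0 : rem 0 = 0.
Proof.
rewrite /rem /exp_stencil big1 ?subrr// => j _.
by rewrite expR0 expr1n subrr mulr0.
Qed.

(** By the mean value theorem the ratio is 1 - (1 - e^t)^i with t strictly between 0 and x. For t <
    0 the base lies in (0, 1); for t > 0 and i odd its power is negative. *)
Lemma exp_stencil_gt0 (x : R) : x != 0 -> odd i \/ x < 0 -> 0 < Phi x / x.
Proof.
move=> x0 hx.
have cont a b : {within `[a, b], continuous (rem : R -> R)}.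
  apply: continuous_subspaceT => t; apply: differentiable_continuous.
  by apply/derivable1_diffP; have [] := rem_derive t.
have [t [tx Et]] : exists t, (if 0 < x then 0 < t else t < 0) /\
    rem x = (1 - expR t) ^+ i * x.
  have [xgt0|xle0] := ltP 0 x.
    have [t] := MVT xgt0 (fun t _ => rem_derive t) (@cont _ _).
    rewrite in_itv/= rem0 !subr0 => /andP[t0 _] ->; by exists t.
  have xlt0 : x < 0 by rewrite lt_neqAle x0.
  have [t] := MVT xlt0 (fun t _ => rem_derive t) (@cont _ _).
  rewrite in_itv/= rem0 !sub0r mulrN => /andP[_ t0] /oppr_inj ->; by exists t.
have -> : Phi x / x = 1 - (1 - expR t) ^+ i.
  have -> : Phi x = x - rem x by rewrite /rem; ring.
  by rewrite Et; field.
rewrite subr_gt0; move: tx; case: ltP => [xgt0 t0|_ t0].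
  case: hx => [oddi|]; last by rewrite ltNge ltW.
  apply: lt_trans ltr01.
  by rewrite exprn_odd_lt0// subr_lt0 expR_gt1.
rewrite exprn_ilt1 -?lt0n// ?subr_ge0 ?expR_le1 ?ltW//.
by rewrite ltrBlDr ltrDl expR_gt0.
Qed.

(** |1 - e^t| <= rad e^rad, and the power of the exponential is e^y with y = i rad <= 1/8, so at
    most 1/(1 - y) <= 8/7. *)
Let drem_bound (rad t : R) : `|t| <= rad -> i%:R * rad <= 1 / 8 ->
  `|(1 - expR t) ^+ i| <= 8 / 7 * rad ^+ i.
Proof.
move=> trad rad8; have rad0 : 0 <= rad by exact: le_trans trad.
have e0 := expR_gt0 t.
have step : `|1 - expR t| <= rad * expR rad.
  have e1 : 1 <= expR rad by rewrite -expR0 ler_expR.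
  apply: (@le_trans _ _ (`|t| * expR `|t|)); last first.
    by rewrite ler_pM ?expR_ge0// ler_expR.
  have := expR_ge1Dx t; have := expR_ge1Dx (- t).
  rewrite -(ler_pM2l e0) -expRD subrr expR0.
  have [t0|t0] := leP 0 t.
    rewrite (ger0_norm t0) ler0_norm; first by lra.
    by rewrite subr_le0 -expR0 ler_expR.
  rewrite (ltr0_norm t0) ger0_norm; last first.
    by rewrite subr_ge0 -expR0 ler_expR ltW.
  have : 1 <= expR (- t) by rewrite -expR0 ler_expR oppr_ge0 ltW.
  nra.
rewrite normrX; apply: le_trans (lerXn2r _ _ _ step) _; rewrite ?nnegrE//.
  by rewrite mulr_ge0// expR_ge0.
rewrite exprMn mulrC ler_wpM2r ?exprn_ge0// -expRM_natl.
set y := _ * rad in rad8 *.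
have ey := expR_gt0 y; have : expR y * (1 - y) <= 1.
  apply: (@le_trans _ _ (expR y * expR (- y))).
    by rewrite ler_wpM2l ?expR_ge1Dx ?ltW.
  by rewrite -expRD subrr expR0.
nra.
Qed.

(** One mean value bound on [0, x] would give 8/7, too much for constant 1. Splitting at x/2, where
    the derivative is at most half as large, gives 8/7 * 3/4 = 6/7, which division by Phi x / x >=
    6/7 turns into 1. *)
Lemma exp_stencil_dist (x : R) : x != 0 -> i%:R * `|x| <= 1 / 8 ->
  0 < Phi x / x /\ `|x / Phi x - 1| <= `|x| ^+ i.
Proof.
move=> x0 ix; have ax : 0 < `|x| by rewrite normr_gt0.
have i1 : 1 <= i%:R :> R by rewrite ler1n.
have x8 : `|x| <= 1 / 8 by nra.
have xi : `|x| ^+ i <= `|x| by rewrite ler_iXnr//; lra.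
have half : `|x / 2| = `|x| / 2 by rewrite normrM normfV (@ger0_norm _ 2).
have far : `|rem x - rem (x / 2)| <= 8 / 7 * `|x| ^+ i * `|x - x / 2|.
  apply: (@derive_lipschitz R rem _ _ `|x| (x / 2) x rem_derive) => [t tx||//].
    exact: drem_bound.
  by rewrite half; lra.
have near : `|rem (x / 2) - rem 0| <= 8 / 7 * (`|x| / 2) ^+ i * `|x / 2 - 0|.
  apply: (@derive_lipschitz R rem _ _ (`|x| / 2) 0 (x / 2) rem_derive) => [t tx||].
  - by apply: drem_bound => //; lra.
  - by rewrite normr0; lra.
  - by rewrite half.
have halfi : (`|x| / 2) ^+ i <= `|x| ^+ i / 2.
  rewrite exprMn; apply: ler_wpM2l; first by rewrite exprn_ge0.
  by rewrite ler_iXnr //; lra.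
have remx : `|rem x| <= 6 / 7 * `|x| ^+ i * `|x|.
  have -> : rem x = (rem x - rem (x / 2)) + (rem (x / 2) - rem 0) by rewrite rem0; ring.
  apply: le_trans (ler_normD _ _) _; apply: le_trans (lerD far near) _.
  rewrite subr0 half (_ : x - x / 2 = x / 2); last by field.
  rewrite half; nra.
have PhiE : Phi x = x - rem x by rewrite /rem; ring.
have rx : `|rem x / x| <= 6 / 7 * `|x| ^+ i.
  by rewrite normrM normfV ler_pdivrMr.
have rx8 : `|rem x / x| <= 6 / 56 by lra.
have Phix : Phi x / x = 1 - rem x / x by rewrite PhiE; field.
have Phi67 : 6 / 7 <= Phi x / x.
  by rewrite Phix; have := ler_norm (rem x / x); lra.
split; first by lra.
have Phin0 : Phi x != 0 by apply: contraTneq Phi67 => ->; rewrite mul0r -ltNge; lra.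
have -> : x / Phi x - 1 = (rem x / x) / (Phi x / x).
  by rewrite {1}(_ : rem x = x - Phi x)//; field; rewrite x0.
rewrite normrM normfV (@ger0_norm _ (Phi x / x)); last by lra.
rewrite ler_pdivrMr; last by lra.
apply: le_trans rx _; rewrite mulrC ler_wpM2l//.
Qed.

End exp_stencil.

(** * Distances between gains *)

Lemma same_sign_gains (R : realFieldType) (B K K' : R) :
  B * K < 0 -> B * K' < 0 -> 0 < K * K'.
Proof.
move=> BK BK'; have : 0 < (B * K) * (B * K') by rewrite nmulr_rgt0.
rewrite mulrACA pmulr_rgt0// -expr2 exprn_even_gt0//.
by apply: contraTneq BK => ->; rewrite mul0r ltxx.
Qed.

Lemma optimal_be_gain_dist (R : realType) (A B sigma : R)
    (S : lqr_system A B sigma) (q r beta dt K : R) :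
  A != 0 -> B != 0 -> q < 0 -> r < 0 -> 0 <= beta -> 0 < dt ->
  `|A * dt| <= 1 / 4 ->
  let gamma := 1 / (beta * dt + 1) in
  optimal_be_gain S dt gamma (dt * gamma * q) (dt * gamma * r) K ->
  `|K - lqr_gain A B q r beta| <=
    24 * ((`|B| * (Num.sqrt (q / r) + `|A| / `|B|) ^+ 2
           + `|A - beta / 2| * (`|A| / `|B|)) * dt).
Proof.
move=> A0 B0 q0 r0 beta0 dt0 x4 gamma hK.
have den0 : 0 < beta * dt + 1 by rewrite ltr_wpDl// mulr_ge0// ltW.
have gamma0 : 0 < gamma by rewrite /gamma divr_gt0.
have gammaK : gamma * (beta * dt + 1) = 1 by rewrite /gamma divfK// gt_eqF.
have [p p0 []] := optimal_be_gain_equations A0 B0 dt0 gamma0 hK.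
set al := expR (A * dt); set b := B / A * (al - 1) => foc val.
have al0 : 0 < al := expR_gt0 _.
(* Hence [b] has the sign of [B], and [b * K < 0] becomes [B * K < 0]. *)
have alA : 0 < (al - 1) / A.
  have [Apos|Aneg] := ltP 0 A.
    by rewrite divr_gt0// subr_gt0 expR_gt1 mulr_gt0.
  have {}Aneg : A < 0 by rewrite lt_neqAle A0.
  by rewrite nmulr_rgt0 ?invr_lt0// subr_lt0 expR_lt1 nmulr_rlt0.
have bB : b = B * ((al - 1) / A) by rewrite /b; ring.
have b0 : b != 0 by rewrite bB mulf_neq0// gt_eqF.
have foc' : dt * r * K + p * b * (al + b * K) = 0.
  apply: (mulfI (lt0r_neq0 gamma0)); rewrite mulr0 -[RHS]foc; ring.
have val' : p * (1 + beta * dt) = dt * (q + r * K ^+ 2) + p * (al + b * K) ^+ 2.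
  rewrite [in LHS]val.
  have -> : (dt * gamma * q + dt * gamma * r * K ^+ 2 + gamma * p * (al + b * K) ^+ 2) *
    (1 + beta * dt) =
    gamma * (beta * dt + 1) * (dt * (q + r * K ^+ 2) + p * (al + b * K) ^+ 2).
    by ring.
  by rewrite gammaK mul1r.
have [bK rootK] := be_gain_root dt0 q0 r0 p0 al0 b0 foc' val'.
have [BK0 rootK0] := lqr_gain_root A beta B0 q0 r0.
have BK : B * K < 0 by move: bK; rewrite bB mulrAC pmulr_llt0.
have rho0 : 0 < q / r by rewrite nmulr_rgt0// invr_lt0.
apply: le_trans (quadratic_root_dist rho0 (same_sign_gains BK0 BK) rootK0 rootK) _.
set bound := (X in 24 * X); have -> : 24 * bound = 2 * (12 * bound) by ring.
rewrite ler_pM2l//.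
exact: (be_coef_dist A0 B0 (ltW rho0) beta0 dt0 x4 erefl erefl).
Qed.

(** The linear coefficients differ by half of [beta / B * (A / D - 1)]; the half cancels the factor
    2 of the root estimate. *)
Lemma optimal_phibe_gain_dist (R : realType) (A B sigma : R)
    (S : lqr_system A B sigma) (i : nat) (c : nat -> R) (q r beta dt K : R) :
  A != 0 -> B != 0 -> q < 0 -> r < 0 -> 0 < dt ->
  let x := A * dt in 0 < exp_stencil i c x / x ->
  optimal_phibe_gain S dt i c q r beta K ->
  `|K - lqr_gain A B q r beta| <=
    `|beta| / `|B| * `|x / exp_stencil i c x - 1|.
Proof.
move=> A0 B0 q0 r0 dt0 x Phi0 hK.
have [p p0 []] := optimal_phibe_gain_equations A0 dt0 hK.
rewrite -/(exp_stencil i c x); set D := _ * exp_stencil _ _ _ => foc val.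
have dtn0 : dt != 0 by rewrite gt_eqF.
have Phin0 : exp_stencil i c x != 0.
  by apply: contraTneq Phi0 => ->; rewrite mul0r ltxx.
have [DA AD] : D / A = exp_stencil i c x / x /\ A / D = x / exp_stencil i c x.
  rewrite /D; move: (exp_stencil i c x) Phin0 => Phi Phin0; rewrite /x.
  by split; field; rewrite ?A0 ?dtn0 ?Phin0.
rewrite -DA in Phi0.
have [BK rootK] := phibe_gain_root A0 B0 r0 p0 Phi0 foc val.
have [BK0 rootK0] := lqr_gain_root A beta B0 q0 r0.
have rho0 : 0 < q / r by rewrite nmulr_rgt0// invr_lt0.
apply: le_trans (quadratic_root_dist rho0 (same_sign_gains BK0 BK) rootK0 rootK) _.
rewrite -AD (_ : _ - _ = 2^-1 * (beta / B * (A / D - 1))); last first.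
  by move: (A / D) => w; field.
by rewrite normrM (@ger0_norm _ 2^-1)// mulrA divff// mul1r !normrM normfV.
Qed.

Theorem theorem4p4 (R : realType) :
  (* Optimal-BE; C0 is the universal constant hidden in "lesssim" *)
  (exists2 C0 : R, 0 < C0 &
    forall A B q r beta : R,
      A != 0 -> B != 0 -> q < 0 -> r < 0 -> 0 <= beta ->
    exists C delta : R, 0 < delta /\
    forall (sigma : R) (S : lqr_system A B sigma) (dt Kt : R),
      (beta = 0 -> sigma = 0) -> 0 < dt -> dt < delta ->
      let gamma := 1 / (beta * dt + 1) in
      optimal_be_gain S dt gamma (dt * gamma * q) (dt * gamma * r) Kt ->
      `|Kt - lqr_gain A B q r beta| <=
        C0 * ((`|B| * (Num.sqrt (q / r) + `|A| / `|B|) ^+ 2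
               + `|A - beta / 2| * (`|A| / `|B|)) * dt)
        + C * dt ^+ 2)
  /\
  (* Optimal-PhiBE *)
  (forall (i : nat) (c : nat -> R) (A B q r beta : R),
      (1 <= i)%N -> phibe_coef i c ->
      A != 0 -> B != 0 -> q < 0 -> r < 0 -> 0 <= beta ->
    exists C delta : R, 0 < delta /\
    forall (sigma : R) (S : lqr_system A B sigma) (dt Kh : R),
      (beta = 0 -> sigma = 0) -> 0 < dt -> dt < delta ->
      optimal_phibe_gain S dt i c q r beta Kh ->
      `|Kh - lqr_gain A B q r beta| <=
        beta * (`|A| ^+ i / `|B|) * dt ^+ i + C * dt ^+ (2 * i))
  /\
  (* Optimal-PhiBE with beta = 0 (hence sigma = 0): exactness; the restriction
     to small dt only bears on the case where i is even and A > 0, in which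
     exactness fails for large dt *)
  (forall (i : nat) (c : nat -> R) (A B q r : R),
      (1 <= i)%N -> phibe_coef i c ->
      A != 0 -> B != 0 -> q < 0 -> r < 0 ->
    exists2 delta : R, 0 < delta &
    forall (S : lqr_system A B 0) (dt Kh : R),
      0 < dt -> [\/ odd i, A < 0 | dt < delta] ->
      optimal_phibe_gain S dt i c q r 0 Kh ->
      Kh = lqr_gain A B q r 0).
Proof.
have small (n A dt : R) : 0 < n -> A != 0 -> 0 < dt -> dt < 1 / (n * `|A|) ->
    n * `|A * dt| <= 1.
  move=> n0 A0 dt0; rewrite ltr_pdivlMr ?mulr_gt0 ?normr_gt0// => /ltW.
  by rewrite normrM (gtr0_norm dt0) mulrC mulrA.
have delta_gt0 (n A : R) : 0 < n -> A != 0 -> 0 < 1 / (n * `|A|).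
  by move=> n0 A0; rewrite divr_gt0// mulr_gt0// normr_gt0.
have xn0 (A dt : R) : A != 0 -> 0 < dt -> A * dt != 0.
  by move=> A0 dt0; rewrite mulf_neq0// gt_eqF.
have small8 (i : nat) (A dt : R) : (1 <= i)%N -> A != 0 -> 0 < dt ->
    dt < 1 / (8 * i%:R * `|A|) -> i%:R * `|A * dt| <= 1 / 8.
  move=> i0 A0 dt0 /(small _ _ _ _ A0 dt0); rewrite mulr_gt0 ?ltr0n// => /(_ isT).
  lra.
split; [exists 24 => // A B q r beta A0 B0 q0 r0 beta0|split].
(* The remainder constant is 0, and this threshold gives [|A * dt| <= 1 / 4]. *)
- exists 0, (1 / (4 * `|A|)); split; first exact: delta_gt0.
  move=> sigma S dt K _ dt0 dtd gamma hK; rewrite mul0r addr0.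
  apply: optimal_be_gain_dist hK => //.
  have := small 4 A dt (ltr0n _ 4) A0 dt0 dtd; lra.
- move=> i c A B q r beta i0 hc A0 B0 q0 r0 beta0.
  (* Again no remainder; the threshold gives [i * |A * dt| <= 1 / 8]. *)
  exists 0, (1 / (8 * i%:R * `|A|)); split.
    by rewrite delta_gt0// mulr_gt0// ltr0n.
  move=> sigma S dt K _ dt0 dtd hK; rewrite mul0r addr0.
  have [Phi0 dist] := exp_stencil_dist i0 hc (xn0 _ _ A0 dt0) (small8 _ _ _ i0 A0 dt0 dtd).
  apply: le_trans (optimal_phibe_gain_dist A0 B0 q0 r0 dt0 Phi0 hK) _.
  rewrite (ger0_norm beta0); apply: le_trans (ler_wpM2l _ dist) _.
    by rewrite divr_ge0.
  by rewrite normrM exprMn (gtr0_norm dt0) le_eqVlt; apply/orP; left; apply/eqP; ring.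
- move=> i c A B q r i0 hc A0 B0 q0 r0; exists (1 / (8 * i%:R * `|A|)).
    by rewrite delta_gt0// mulr_gt0// ltr0n.
  move=> S dt K dt0 cond hK.
  have Phi0 : 0 < exp_stencil i c (A * dt) / (A * dt).
    case: cond => [oddi|Aneg|dtd].
    + by apply: exp_stencil_gt0 => //; [exact: xn0|left].
    + by apply: exp_stencil_gt0 => //; [exact: xn0|right; rewrite pmulr_llt0].
    + by have [] := exp_stencil_dist i0 hc (xn0 _ _ A0 dt0) (small8 _ _ _ i0 A0 dt0 dtd).
  have := optimal_phibe_gain_dist A0 B0 q0 r0 dt0 Phi0 hK.
  (* The distance bound carries the factor [|beta|], here 0. *)
  by rewrite normr0 !mul0r normr_le0 subr_eq0 => /eqP.
Qed.
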